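(* For each integer $n\ge 0$ let $\pi(n)$ be the number of prime numbers less than or equal to $n$. Then the sequence $(\pi(n))_{n\ge 0}$ is not holonomic.
   Context: A sequence $(f_n)_{n\ge0}$ of complex numbers is called holonomic (or $P$-recursive) if there exist an integer $d\ge 0$ and polynomials $p_0,\dots,p_d\in\mathbb{C}[X]$, not all zero, such that $p_0(n)f_{n+d}+p_1(n)f_{n+d-1}+\cdots+p_d(n)f_n=0$ for all integers $n\ge 0$. *)

(* Defs.v *)
From mathcomp Require Import all_boot all_order all_algebra.
From mathcomp Require Import reals complex.

Set Implicit Arguments.
Unset Strict Implicit.
Unset Printing Implicit Defensive.

Import GRing.Theory.
Local Open Scope ring_scope.

(* For R : realType, R[i] is the field of complex numbers.
   The natural subtraction is never truncated, as i <= d. *)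
Definition holonomic (R : realType) (f : nat -> R[i]) : Prop :=
  exists (d : nat) (p : 'I_d.+1 -> {poly R[i]}),
    (exists i, p i != 0) /\
    (forall n : nat, \sum_(i < d.+1) (p i).[n%:R] * f (n + d - i)%N = 0).

Definition prime_pi (n : nat) : nat := #|[set p : 'I_n.+1 | prime p]|.

(* Main.v *)
Require Import Defs.
From mathcomp Require Import all_boot all_order all_algebra.
From mathcomp Require Import reals complex.
From mathcomp Require Import zify.

Set Implicit Arguments.
Unset Strict Implicit.
Unset Printing Implicit Defensive.

Import GRing.Theory.
Local Open Scope ring_scope.

(** The only arithmetic input is that there are arbitrarily long prime gaps
    arbitrarily far out.  Let [S] be the sum of the coefficients [p_i].  On a
    window lying inside a gap the recurrence reads [S(n) pi(n) = 0], so [S] has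
    infinitely many roots and vanishes.  If [p_i = 0] for all [i < m], slide the
    window so that its entry of index [m] sits on the prime [q] ending a long
    gap: the entries of larger index all equal [pi(q) - 1], and since [S = 0]
    the recurrence reads [p_m(n) = 0].  Hence all [p_i] vanish. *)

Lemma prime_piS n : prime_pi n.+1 = (prime_pi n + prime n.+1)%N.
Proof.
have E k : prime_pi k = (\sum_(i < k.+1) prime i)%N.
  rewrite /prime_pi -sum1_card big_mkcond.
  by apply: eq_bigr => i _; rewrite inE; case: prime.
by rewrite !E big_ord_recr.
Qed.

Lemma prime_pi_gt0 n : (1 < n)%N -> (0 < prime_pi n)%N.
Proof.
move=> n1; apply/card_gt0P; exists (Ordinal (n1 : 2 < n.+1)%N).
by rewrite inE.
Qed.

Lemma not_prime_fact_add m i : (1 < i <= m)%N -> ~~ prime (m`! + i).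
Proof.
move=> /andP[i1 im]; apply/negP => /primeP[_ /(_ i)].
rewrite dvdn_addl // dvdn_fact ?im ?(ltnW i1) // => /(_ isT).
have := fact_gt0 m; lia.
Qed.

(** Take [q] to be the least prime above m! + 1. As m! + 2, ..., m! + m are composite, [q] exceeds
    m! + m, and minimality of [q] leaves no prime in between. *)
Lemma prime_after_gap N k :
  exists n, [/\ (N <= n)%N, prime (n + k) &
                forall j, (j < k)%N -> prime_pi (n + j) = prime_pi n].
Proof.
(* With this [m], the window start [q - k] exceeds both [N] and m! + 1. *)
set m := (N + k).+2.
have [q0 q0m pq0] := prime_above (m`! + 1).
have exq : exists q, (m`! + 1 < q)%N && prime q by exists q0; rewrite q0m.
case: (ex_minnP exq) => q /andP[qm pq] qmin.
have mq : (m`! + m < q)%N.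
  rewrite ltnNge; apply/negP => qlem.
  have : ~~ prime (m`! + (q - m`!)) by apply: not_prime_fact_add; lia.
  by rewrite subnKC ?pq //; lia.
exists (q - k)%N; rewrite subnK; last by lia.
split=> //; first by lia.
elim=> [|j IHj] jk; first by rewrite addn0.
rewrite addnS prime_piS IHj; last by lia.
case: (boolP (prime _)) => [pj|_]; last by rewrite addn0.
have := qmin (q - k + j).+1; rewrite pj andbT => /(_ ltac:(lia)); lia.
Qed.

Lemma poly_eq0_infinite_nat_roots (F : numDomainType) (p : {poly F}) :
  (forall N : nat, exists2 n : nat, (N <= n)%N & root p n%:R) -> p = 0.
Proof.
move=> infp; apply/eqP; apply/negPn/negP => p0.
(* [size p] distinct roots are one more than the degree allows; each new root is chosen beyond the
   head, the largest so far. *)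
have [s [ss srt rts]] : exists s : seq nat,
    [/\ size s = size p, sorted gtn s & all (fun n : nat => root p n%:R) s].
  elim: (size p) => [|k [s [<- srt rts]]]; first by exists [::].
  have [n ns rn] := infp (head 0 s).+1%N.
  exists (n :: s); split=> //=; last by rewrite rn.
  by case: s ns srt {rts} => //= a s ->.
have := max_poly_roots p0 (rs := [seq n%:R | n : nat <- s]).
rewrite all_map size_map ss ltnn => H; suff : false by [].
apply: H; first exact: rts.
rewrite map_inj_uniq => [|x y /eqP]; last by rewrite Num.Theory.eqr_nat => /eqP.
apply: (sorted_uniq _ _ srt) => [x y z|x]; rewrite /= ?ltnn //; lia.
Qed.

Theorem mainTheorem4 (R : realType) :
  ~ holonomic (fun n : nat => (prime_pi n)%:R : R[i]).
Proof.
move=> [d [p [[i0 pi0] rec]]].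
have S0 : \sum_i p i = 0.
  apply: poly_eq0_infinite_nat_roots => N.
  (* [N.+2] forces [n] to be at least 2, so that [prime_pi n] can be cancelled. *)
  have [n [Nn _ gap]] := prime_after_gap N.+2 d.+1.
  exists n; first by lia.
  have := rec n.
  rewrite (eq_bigr (fun i => (p i).[n%:R] * (prime_pi n)%:R)); last first.
    move=> [i id] _; congr (_ * _%:R) => /=.
    by rewrite -addnBA // gap //; lia.
  rewrite -mulr_suml -horner_sum => /eqP; rewrite mulf_eq0 => /orP[//|].
  by rewrite Num.Theory.pnatr_eq0 -leqn0 leqNgt prime_pi_gt0; last by lia.
have p0 m (md : (m < d.+1)%N) : p (Ordinal md) = 0.
  elim/ltn_ind: m md => m IHm md.
  apply: poly_eq0_infinite_nat_roots => N.
  have [n [Nn pr gap]] := prime_after_gap N d.+1.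
  (* At this argument entry [i] sits at n + d + 1 + (m - i): on the prime for i = m, inside the gap
     for i > m. *)
  exists (n + m).+1; first by lia.
  have piq : prime_pi (n + d.+1) = (prime_pi n).+1.
    by rewrite addnS prime_piS gap // -addnS pr addn1.
  have := rec (n + m).+1.
  (* Entries past the prime (i < m) may be given the value [prime_pi n] too, since their
     coefficients vanish by induction. *)
  rewrite (eq_bigr (fun i => (p i).[(n + m).+1%:R] * (prime_pi n)%:R
      + (i == Ordinal md)%:R * (p i).[(n + m).+1%:R])); last first.
    move=> [i id] _; rewrite -val_eqE /=.
    case: (ltngtP i m) => [im|im|im].
    - by rewrite IHm // horner0 !(mul0r, mulr0) addr0.
    - rewrite mul0r addr0; congr (_ * _%:R).
      by rewrite -(gap (m + d.+1 - i)%N); [congr prime_pi|]; lia.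
    - have -> : ((n + m).+1 + d - i)%N = (n + d.+1)%N by lia.
      by rewrite piq mul1r -(natr1 (prime_pi n)) mulrDr mulr1.
  rewrite big_split /= -mulr_suml -horner_sum S0 horner0 mul0r add0r.
  rewrite (bigD1 (Ordinal md)) //= eqxx mul1r big1 ?addr0 => [/eqP//|i].
  by move=> /negbTE->; rewrite mul0r.
by case: i0 pi0 => m md; rewrite p0 eqxx.
Qed.
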